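(* Let $D$ be a division ring, let $n\ge 1$, and let $R=D[x_1,\dots,x_n]$ be the polynomial ring over $D$ in $n$ central indeterminates. For every left ideal $I$ of $R$, $$\bigcap_{I\subseteq M}M=\Big\{f\in R\;\Big|\;\text{for every } g\in R \text{ there exists an integer } N\ge 1 \text{ such that } (gf)^N\in\sum_{i=0}^{N-1}I(gf)^i\Big\},$$ where the intersection is taken over all maximal left ideals $M\subset R$ containing $I$.
   Context: All rings are associative and unital. ''Central indeterminates'' means that the $x_i$ commute with each other and with all elements of $D$. For a left ideal $I$ and $a\in R$, $Ia^i=\{ra^i: r\in I\}$, with $a^0=1$, so that $\sum_{i=0}^{N-1} I a^i$ is the set of all elements $r_0+r_1a+\cdots+r_{N-1}a^{N-1}$ with $r_0,\dots,r_{N-1}\in I$. An intersection over an empty family of left ideals of a ring is understood to be the whole ring. *)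

(* Defs.v *)
From HB Require Import structures.
From mathcomp Require Import all_boot all_order all_algebra.
From mathcomp Require Import boolp classical_sets.
From mathcomp Require Import mpoly.

Set Implicit Arguments.
Unset Strict Implicit.
Unset Printing Implicit Defensive.

Import GRing.Theory.
Local Open Scope classical_set_scope.
Local Open Scope ring_scope.

(* [1 != 0] is part of the structure [unitRingType], so a division ring is
   automatically nonzero. *)
Definition division_ring (D : unitRingType) : Prop :=
  forall x : D, x != 0 -> x \is a GRing.unit.

(* MathComp's [idealr_closed] is about boolean predicates and requires the ideal
   to be proper; here a left ideal is an arbitrary subset, possibly the whole
   ring. Closure under opposites follows by multiplying by [-1]. *)
Definition left_ideal (R : pzRingType) (I : set R) : Prop :=
  [/\ I 0,
      forall x y, I x -> I y -> I (x + y) &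
      forall a x, I x -> I (a * x)].

Definition maximal_left_ideal (R : pzRingType) (M : set R) : Prop :=
  [/\ left_ideal M,
      M <> setT &
      forall J : set R, left_ideal J -> M `<=` J -> J = M \/ J = setT].

(* The set [I + I a + ... + I a^(N-1)]. *)
Definition left_power_sum (R : pzRingType) (I : set R) (a : R) (N : nat) :
    set R :=
  [set x | exists2 r : 'I_N -> R,
             forall i, I (r i) & x = \sum_(i < N) r i * a ^+ i].

(* Main.v *)
(* Write R = D[x_1, ..., x_n] and T = R['X]. If a = g f lies in every maximal left
   ideal over I but the left ideal of T generated by I and 1 - 'X a is proper,
   take a maximal left ideal M of T containing it. By the Amitsur-Small theorem,
   T / M is finitely generated over D, hence it has a maximal R-submodule N / M;
   transporting N by a power of 'X gives a maximal left ideal of R that contains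
   I but not a, a contradiction. So 1 lies in the ideal generated by I and
   1 - 'X a, and comparing coefficients yields the relation for a.

   Amitsur-Small theorem: by Noether normalization (the Nagata substitution works
   over D, since the leading coefficient of a relation is a unit), T / M is
   finitely generated over A = D[z_1, ..., z_r], with z_i central and A meeting M
   trivially. If r > 0, then c = z_1 acts bijectively on the simple module T / M.
   The submodules c^(-k) A 1 form an ascending chain of A-submodules of a
   Noetherian module, so 1 = c a modulo M for some a in A, and 1 - c a is a
   nonzero element of A in M. *)

Require Import Defs.
From mathcomp Require Import all_boot all_order all_algebra.
From mathcomp Require Import boolp classical_sets.
From mathcomp Require Import mpoly.

Import GRing.Theory.

Local Open Scope classical_set_scope.
Local Open Scope ring_scope.

(** * Submodules as stable subsets, and Hilbert's basis theorem *)

Section StableSubsets.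
Context {T : nzRingType}.
Implicit Types (P M N U V W : set T) (s : seq T).

(** [P] need only contain [-1] and generators of the ring of scalars. Submodules of [T / M] are
    stable sets containing [M], so no quotient is formed. *)
Definition stable P U : Prop :=
  [/\ U 0, forall x y, U x -> U y -> U (x + y) &
      forall p x, P p -> U x -> U (p * x)].

Definition central (x : T) : Prop := forall y, GRing.comm y x.

Lemma stable_sub P Q U : P `<=` Q -> stable Q U -> stable P U.
Proof. by move=> PQ [U0 UD UM]; split=> // p x /PQ; apply: UM. Qed.

Lemma stableB P U x y : P (- 1) -> stable P U -> U x -> U y -> U (x - y).
Proof.
by move=> P1 [_ UD UM] Ux Uy; apply: UD => //; rewrite -mulN1r; apply: UM.
Qed.

Lemma stable_sum P U (K : Type) (r : seq K) (Q : pred K) (F : K -> T) :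
  stable P U -> (forall i, Q i -> U (F i)) -> U (\sum_(i <- r | Q i) F i).
Proof. by case=> U0 UD _ UF; apply: (@big_ind _ U). Qed.

Definition maximal_stable P N : Prop :=
  [/\ stable P N, N <> setT &
      forall U, stable P U -> N `<=` U -> U = N \/ U = setT].

(** Avoiding one fixed element, unlike being proper, always survives unions of chains. *)
Lemma exists_maximal_avoiding P W t : stable P W -> ~ W t ->
  exists N, [/\ stable P N, W `<=` N, ~ N t &
    forall U, stable P U -> N `<=` U -> ~ U t -> U = N].
Proof.
move=> Ws Wt.
(* Uniting with [W] takes care of the empty chain in Zorn's lemma. *)
pose Q := [set X : set T | stable P (W `|` X) /\ ~ (W `|` X) t].
have [F FQ Ftot|A [[As At] Amax]] := @Zorn_bigcup _ Q.
  have [W0 WD WM] := Ws.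
  have inF X x : F X -> X x -> (W `|` \bigcup_(X in F) X) x.
    by move=> FX Xx; right; exists X.
  have FU X : F X -> W `|` X `<=` W `|` \bigcup_(X in F) X.
    by move=> FX x [Wx|Xx]; [left|exact: inF Xx].
  split; last by case=> [//|[X FX Xt]]; have [_ []] := FQ X FX; right.
  split=> [|x y [Wx|[X FX Xx]] [Wy|[Y FY Yy]]|p x Pp [Wx|[X FX Xx]]].
  - by left.
  - by left; apply: WD.
  - by have [[_ D _] _] := FQ Y FY; apply: (FU _ FY); apply: D; [left|right].
  - by have [[_ D _] _] := FQ X FX; apply: (FU _ FX); apply: D; [right|left].
  - have [XY|YX] := Ftot _ _ FX FY.
      have [[_ D _] _] := FQ Y FY; apply: (FU _ FY).
      by apply: D; right=> //; apply: XY.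
    have [[_ D _] _] := FQ X FX; apply: (FU _ FX).
    by apply: D; right=> //; apply: YX.
  - by left; apply: WM.
  - by have [[_ _ M] _] := FQ X FX; apply: (FU _ FX); apply: M => //; right.
exists (W `|` A); split=> //.
move=> U Us WAU Ut; apply/seteqP; split=> // x Ux; right.
have AU : A `<=` U by move=> a Aa; apply: WAU; right.
apply: contrapT => Ax; apply: (Amax U); first by split=> // UA; apply/Ax/UA.
suff WU : W `|` U = U by rewrite /Q /= WU; split=> // -[].
by apply/seteqP; split=> w; [case=> [Ww|//]; apply: WAU; left|right].
Qed.

(** Induction on the generators. Adjoin [t] to [W]: if the result is proper, the remaining
    generators suffice; otherwise a stable set above [W] is proper exactly when it avoids [t]. *)
Lemma exists_maximal_stable P W s : stable P W -> W <> setT ->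
    (forall U, stable P U -> W `<=` U -> (forall t, t \in s -> U t) ->
      U = setT) ->
  exists2 N, maximal_stable P N & W `<=` N.
Proof.
elim: s W => [|t s IHs] W Ws WT gen; first by case: WT; apply: gen.
pose W' := [set f | forall U, stable P U -> W `<=` U -> U t -> U f].
have WW' : W `<=` W' by move=> f Wf U _ WU _; apply: WU.
have W't : W' t by [].
have W's : stable P W'.
  split=> [U [] //|x y W'x W'y U Us WU Ut|p x Pp W'x U Us WU Ut].
    by have [_ D _] := Us; apply: D; [exact: (W'x U)|exact: (W'y U)].
  by have [_ _ M] := Us; apply: M => //; apply: W'x.
have [W'T|/eqP W'T] := eqVneq W' setT; last first.
  have [U Us W'U Us'|N Nmax W'N] := IHs _ W's W'T.
    apply: gen => // [x Wx|u]; first by apply: W'U; apply: WW'.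
    by rewrite in_cons => /predU1P[->|/Us' //]; apply: W'U.
  by exists N => //; apply: subset_trans W'N.
have Wt : ~ W t.
  move=> Wt; apply: WT; apply/seteqP; split=> // x _.
  by suff: W' x by [apply]; rewrite W'T.
have [N [Ns WN Nt Nmax]] := exists_maximal_avoiding _ _ _ Ws Wt.
exists N => //; split=> // [NT|U Us NU]; first by apply: Nt; rewrite NT.
have [Ut|Ut] := pselect (U t); last by left; apply: Nmax.
right; apply/seteqP; split=> // x _.
have : W' x by rewrite W'T.
by apply=> //; apply: subset_trans NU.
Qed.

(* Only the stable subsets between [M] and [V] are considered, so that this is
   the ascending chain condition for the module [V / M]. *)
Definition acc P M V : Prop :=
  forall U : nat -> set T, (forall k, stable P (U k)) ->
    (forall k, U k `<=` U k.+1) -> (forall k, M `<=` U k) ->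
    (forall k, U k `<=` V) ->
  exists k, forall j, (k <= j)%N -> U j `<=` U k.

Lemma chain_le (U : nat -> set T) (j k : nat) :
  (forall k, U k `<=` U k.+1) -> (j <= k)%N -> U j `<=` U k.
Proof.
move=> Uinc /subnK <-; elim: (k - j)%N => [//|i IH] x Ux.
by rewrite addSn; apply/Uinc/IH.
Qed.

(** The filtration by degree in [x]: [M + V + x V + ... + x^(n-1) V]. *)
Fixpoint layers (x : T) M V (n : nat) : set T :=
  if n is k.+1 then
    [set f | exists u g, [/\ V u, layers x M V k g & f = x ^+ k * u + g]]
  else M.

Section Layers.
Context {P M V : set T} {x : T}.
Hypotheses (xC : central x) (Ms : stable (P `|` [set x]) M).
Hypotheses (Vs : stable P V) (MV : M `<=` V).

Local Notation lay := (layers x M V).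

Lemma stable_layers n : stable P (lay n).
Proof.
elim: n => [|n [L0 LD LM]] /=; first by apply: stable_sub Ms => p; left.
have [V0 VD VM] := Vs; split.
- by exists 0, 0; rewrite mulr0 addr0.
- move=> _ _ [u [g [Vu Lg ->]]] [u' [g' [Vu' Lg' ->]]].
  by exists (u + u'), (g + g'); rewrite mulrDr addrACA; split; auto.
- move=> p _ Pp [u [g [Vu Lg ->]]]; exists (p * u), (p * g).
  split; [exact: VM|exact: LM|].
  by rewrite mulrDr !mulrA (commrX n (xC p)).
Qed.

Lemma layers_succ n : lay n `<=` lay n.+1.
Proof.
move=> f Lf; exists 0, f; split=> //; first by have [] := Vs.
by rewrite mulr0 add0r.
Qed.

Lemma layers_mulx n f : lay n f -> lay n.+1 (x * f).
Proof.
elim: n f => [|n IHn] f.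
  by move=> Mf; apply/layers_succ; have [_ _ MM] := Ms; apply: MM => //; right.
move=> [u [g [Vu Lg ->]]]; exists u, (x * g); split=> //; first exact: IHn.
by rewrite mulrDr mulrA exprS.
Qed.

Lemma stable_bigcup_layers : stable (P `|` [set x]) (\bigcup_n lay n).
Proof.
split.
- by exists 0 => //=; have [] := Ms.
- move=> f g [m _ Lf] [n _ Lg]; exists (m + n)%N => //.
  have [_ D _] := stable_layers (m + n); apply: D.
    exact: (chain_le _ _ _ layers_succ (leq_addr _ _)) Lf.
  exact: (chain_le _ _ _ layers_succ (leq_addl _ _)) Lg.
- move=> p f [Pp|->] [n _ Lf]; last by exists n.+1 => //; apply: layers_mulx.
  by exists n => //; have [_ _ A] := stable_layers n; apply: A.
Qed.

(* Hilbert's basis theorem: a stable subset is determined, inside a larger one,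
   by the leading coefficients of its elements in each degree. *)
Lemma acc_layers : P (- 1) -> acc P M V ->
  acc (P `|` [set x]) M (\bigcup_n lay n).
Proof.
move=> P1 accV U Us' Uinc MU UV.
have Us k : stable P (U k) by apply: stable_sub (Us' k) => p; left.
have Ux k f : U k f -> U k (x * f).
  by case: (Us' k) => _ _; apply; right.
pose L i k := [set u | V u /\ exists2 g, lay k g & U i (x ^+ k * u + g)].
have Ls i k : stable P (L i k).
  have [V0 VD VM] := Vs; have [U0 UD UM] := Us i.
  have [l0 lD lM] := stable_layers k; split.
  - by split=> //; exists 0 => //; rewrite mulr0 addr0.
  - move=> u v [Vu [g lg Ug]] [Vv [h lh Uh]]; split; first exact: VD.
    by exists (g + h); [exact: lD|rewrite mulrDr addrACA; exact: UD].
  - move=> p u Pp [Vu [g lg Ug]]; split; first exact: VM.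
    exists (p * g); first exact: lM.
    by rewrite mulrA -(commrX k (xC p)) -mulrA -mulrDr; apply: UM.
have ML i k : M `<=` L i k.
  move=> m Mm; split; first exact: MV.
  exists 0; first by have [] := stable_layers k.
  rewrite addr0; apply: MU; elim: k => [|k]; first by rewrite mul1r.
  have [_ _ MM] := Ms; rewrite exprS -mulrA.
  by apply: MM; right.
have Linc i k : L i k `<=` L i.+1 k.
  by move=> u [Vu [g lg Ug]]; split=> //; exists g => //; apply: Uinc.
have Lup i k : L i k `<=` L i k.+1.
  move=> u [Vu [g lg Ug]]; split=> //; exists (x * g).
    exact: layers_mulx.
  by rewrite exprS -mulrA -mulrDr; apply: Ux.
(* [L] increases in both indices. Once its diagonal is stable from [n0] on, only the finitely many
   degrees below [n0] are left. *)
have [n0 stab0] : exists k, forall j, (k <= j)%N -> L j j `<=` L k k.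
  apply: (accV (fun k => L k k)) => // k u; first by move=> /Linc /Lup.
  by case.
have [n1 [n01 stab1]] : exists n, (n0 <= n)%N /\
    forall k j, (k < n0)%N -> (n <= j)%N -> L j k `<=` L n k.
  elim: {2}n0 => [|b [n [n0n IH]]].
    by exists n0; split=> // k j; rewrite ltn0.
  have [m stabm] : exists m, forall j, (m <= j)%N -> L j b `<=` L m b.
    by apply: (accV (L ^~ b)) => // k u [].
  exists (maxn n m); split; first by rewrite leq_max n0n.
  move=> k j; rewrite ltnS leq_eqVlt geq_max => /predU1P[->|kb] /andP[nj mj] u.
    by move=> /(stabm _ mj); apply: (chain_le (L ^~ b)); rewrite ?leq_maxr.
  by move=> /(IH _ _ kb nj); apply: (chain_le (L ^~ k)); rewrite ?leq_maxl.
(* In degrees [k >= n0], go up from [L j k] to the diagonal, which is contained in [L n0 n0], hence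
   in [L n1 k]. *)
have stab k j : (n1 <= j)%N -> L j k `<=` L n1 k.
  move=> n1j u; have [kn0|n0k] := ltnP k n0; first exact: stab1.
  move=> /(chain_le (L ^~ k) _ (maxn j k) (Linc ^~ k) (leq_maxl _ _)).
  move=> /(chain_le (L _) _ _ (Lup _) (leq_maxr j _)).
  move=> /stab0; rewrite leq_max n0k orbT => /(_ isT).
  by move=> /(chain_le (L _) _ _ (Lup _) n0k); apply: (chain_le (L ^~ k)).
exists n1 => j n1j f Uf; have [n _ lf] := UV _ _ Uf.
(* Induction on the degree: subtract from [f] an element of [U n1] with the same leading
   coefficient. *)
elim: n f lf Uf => [|n IHn] f; first by move=> /MU.
move=> [u [g [Vu lg ->]]] Uf.
have /(stab _ _ n1j)[_ [g' lg' Ug']] : L j n u by split=> //; exists g.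
have Ujg' := chain_le U _ _ Uinc n1j _ Ug'.
have gg' : U n1 (g - g').
  apply: IHn; first exact: stableB P1 (stable_layers n) lg lg'.
  by have := stableB _ _ _ _ P1 (Us j) Uf Ujg'; rewrite opprD addrACA subrr add0r.
have [_ UD _] := Us n1.
by have := UD _ _ Ug' gg'; rewrite -addrA [g' + _]addrC subrK.
Qed.

End Layers.
End StableSubsets.

(** * Noether normalization over a division ring and the Amitsur-Small theorem *)

Lemma base_expansion_inj (B n : nat) (f g : 'I_n -> nat) :
    (forall i, (f i < B)%N) -> (forall i, (g i < B)%N) ->
  (\sum_(i < n) B ^ i * f i = \sum_(i < n) B ^ i * g i)%N -> f =1 g.
Proof.
elim: n f g => [f g _ _ _ []//|n IHn] f g fB gB.
rewrite !big_ord_recl !expn0 !mul1n.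
have shift (h : 'I_n.+1 -> nat) :
    (\sum_(i < n) B ^ lift ord0 i * h (lift ord0 i) =
    (\sum_(i < n) B ^ i * h (lift ord0 i)) * B)%N.
  rewrite big_distrl; apply: eq_bigr => i _.
  by rewrite lift0 expnS -mulnA mulnC.
rewrite !shift ![(_ + _ * B)%N]addnC => E.
have fg0 : f ord0 = g ord0.
  by have := congr1 (modn^~ B) E; rewrite /= !modnMDl !modn_small.
have B0 : (0 < B)%N by apply: leq_ltn_trans (fB ord0).
move: E; rewrite fg0 => /addIn/eqP; rewrite eqn_pmul2r // => /eqP E i.
have [j ->|->//] := unliftP ord0 i.
exact: (IHn (f \o lift ord0) (g \o lift ord0) (fun=> fB _) (fun=> gB _) E).
Qed.

Section NoetherNormalization.
Context {D : unitRingType} {T : nzRingType} {phi : {rmorphism D -> T}}.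
Hypothesis hD : division_ring D.
Context {M : set T}.
Hypothesis idM : stable setT M.
Implicit Types (U V : set T) (z s : seq T).

(** Its stable sets are the submodules over the subring generated by [D] and [z]. *)
Definition scalars_and z : set T :=
  [set p | (exists d, p = phi d) \/ p \in z].

Lemma scalars_and_cons x z :
  scalars_and (x :: z) = scalars_and z `|` [set x].
Proof.
apply/seteqP; split=> p.
  move=> [[d ->]|]; first by left; left; exists d.
  by rewrite in_cons => /predU1P[->|pz]; [right|left; right].
move=> [[[d ->]|pz]|->]; [by left; exists d|right|right].
  by rewrite in_cons pz orbT.
by rewrite in_cons eqxx.
Qed.

Lemma scalars_andC z d : scalars_and z (phi d).
Proof. by left; exists d. Qed.

Lemma scalars_andN1 z : scalars_and z (- 1).
Proof. by left; exists (- 1); rewrite rmorphN1. Qed.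

(** [V' / V] has dimension at most one over [D]: a chain in [V'] either stays in [V] or reaches some
    [t + v], after which its trace on [V] determines it. *)
Lemma acc_line V t : stable (scalars_and [::]) V -> M `<=` V ->
    acc (scalars_and [::]) M V ->
  let V' := [set f | exists d v, V v /\ f = phi d * t + v] in
  stable (scalars_and [::]) V' /\ acc (scalars_and [::]) M V'.
Proof.
move=> Vs MV accV V'; have [V0 VD VM] := Vs; split.
  split.
  - by exists 0, 0; rewrite rmorph0 mul0r addr0.
  - move=> _ _ [d [v [Vv ->]]] [e [w [Vw ->]]]; exists (d + e), (v + w).
    by rewrite rmorphD mulrDl addrACA; split=> //; apply: VD.
  - move=> _ _ [[c ->]|//] [d [v [Vv ->]]]; exists (c * d), (phi c * v).
    by rewrite mulrDr rmorphM mulrA; split=> //; apply: VM => //; left; exists c.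
move=> U Us Uinc MU UV.
have [n stab] : exists k, forall j, (k <= j)%N -> U j `&` V `<=` U k `&` V.
  apply: (accV (fun k => U k `&` V)) => k.
  - have [U0 UD UM] := Us k.
    split=> [//|x y [Ux Vx] [Uy Vy]|p x Pp [Ux Vx]].
      by split; [exact: UD|exact: VD].
    by split; [exact: UM|exact: VM].
  - by move=> x [Ux Vx]; split=> //; apply: Uinc.
  - by move=> m Mm; split; [exact: MU|exact: MV].
  - by move=> x [].
have [[k [v [Vv Uv]]]|noU] := pselect (exists k v, V v /\ U k (t + v)).
  exists (maxn n k) => j; rewrite geq_max => /andP[nj kj] f Uf.
  have {}Uv : U (maxn n k) (t + v).
    exact: (chain_le U _ _ Uinc (leq_maxr n k)) Uv.
  have [d [w [Vw fE]]] := UV _ _ Uf.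
  have [_ UD UM] := Us (maxn n k).
  have Udv : U (maxn n k) (phi d * (t + v)).
    by apply: UM => //; apply: scalars_andC.
  rewrite -[f](subrK (phi d * (t + v))); apply: UD => //.
  apply: (chain_le U _ _ Uinc (leq_maxl n k)).
  suff [] : (U n `&` V) (f - phi d * (t + v)) by [].
  apply: (stab _ nj); split.
    apply: stableB (scalars_andN1 [::]) (Us j) Uf _.
    by apply: (chain_le U _ _ Uinc _) Udv; rewrite geq_max nj.
  rewrite fE mulrDr opprD addrACA subrr add0r.
  apply: stableB (scalars_andN1 [::]) Vs Vw _.
  by apply: VM => //; apply: scalars_andC.
exists n => j nj f Uf; have [d [v [Vv fE]]] := UV _ _ Uf.
suff d0 : d = 0.
  suff [] : (U n `&` V) f by [].
  by apply: (stab _ nj); split; rewrite // fE d0 rmorph0 mul0r add0r.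
apply: contrapT => /eqP d0; case: noU; exists j, (phi d^-1 * v).
split; first by apply: VM => //; apply: scalars_andC.
have [_ _ UM] := Us j; have := UM _ _ (scalars_andC _ d^-1) Uf.
by rewrite fE mulrDr mulrA -rmorphM mulVr ?rmorph1 ?mul1r //; apply: hD.
Qed.

(** For empty [z], [V] is [M] plus the [D]-span of [s]; each further variable replaces [V] by the
    union of its layers. *)
Lemma acc_finitely_generated z s : (forall x, x \in z -> central x) ->
  exists V, [/\ stable (scalars_and z) V, M `<=` V,
    forall t, t \in s -> V t & acc (scalars_and z) M V].
Proof.
have Ms P : stable P M by apply: stable_sub idM.
elim: z => [_|x z IHz zC].
  elim: s => [|t s [V [Vs MV sV accV]]].
    exists M; split=> //.
    by move=> U _ _ MU UM; exists 0 => j _; apply: subset_trans (MU _).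
  have [V's accV'] := acc_line _ t Vs MV accV.
  have VV' v : V v -> exists d w, V w /\ v = phi d * t + w.
    by exists 0, v; rewrite rmorph0 mul0r add0r.
  exists [set f | exists d v, V v /\ f = phi d * t + v]; split=> //.
    by move=> m Mm; apply/VV'/MV.
  move=> u; rewrite in_cons => /predU1P[->|us]; last exact/VV'/sV.
  exists 1, 0; rewrite rmorph1 mul1r addr0; split=> //.
  by have [] := Vs.
have [|V [Vs MV sV accV]] := IHz.
  by move=> y yz; apply: zC; rewrite in_cons yz orbT.
have xC : central x by apply: zC; rewrite in_cons eqxx.
exists (\bigcup_n layers x M V n); rewrite scalars_and_cons; split.
- exact: stable_bigcup_layers.
- by move=> m Mm; exists 0.
- move=> t ts; exists 1 => //; exists t, 0.
  by rewrite mul1r addr0; split=> //; [exact: sV|have [] := idM].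
- by apply: acc_layers => //; apply: scalars_andN1.
Qed.

(* [s] generates [T / M] over the subring generated by [D] and [z]. *)
Definition generates z s : Prop :=
  forall U, stable (scalars_and z) U -> M `<=` U -> (forall t, t \in s -> U t) ->
    U = setT.

(** Centrality lets a relation in the left ideal [M] be multiplied by the generators on the
    right. *)
Definition finite_over z : Prop :=
  exists2 s, forall t, t \in s -> central t & generates z s.

Lemma acc_finite_over z : (forall x, x \in z -> central x) -> finite_over z ->
  acc (scalars_and z) M setT.
Proof.
move=> zC [s _ zs]; have [V [Vs MV sV accV]] := acc_finitely_generated z s zC.
by rewrite -(zs V).
Qed.

Definition eval_at z (p : {mpoly D[size z]}) : T :=
  mmap phi (fun i : 'I_(size z) => z`_i) p.

Lemma nth_central z i : (forall x, x \in z -> central x) -> central z`_i.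
Proof.
move=> zC; have [iz|zi] := ltnP i (size z); first exact/zC/mem_nth.
by rewrite nth_default // => y; apply: commr0.
Qed.

Lemma mmap1_central n (h : 'I_n -> T) m :
  (forall i, central (h i)) -> central (mmap1 h m).
Proof.
move=> hC x; rewrite /mmap1; elim/big_rec: _ => [|i y _ xy]; first exact: commr1.
by apply: commrM => //; apply: commrX; apply: hC.
Qed.

Lemma eval_atM z p q : (forall x, x \in z -> central x) ->
  eval_at z (p * q) = eval_at z p * eval_at z q.
Proof.
move=> zC; have hC (i : 'I_(size z)) : central z`_i by apply: nth_central.
have mC (r : {mpoly D[size z]}) m m' :
    GRing.comm (phi r@_m) (mmap1 (fun i : 'I_(size z) => z`_i) m').
  exact: mmap1_central.
rewrite /eval_at.
by have [->] := commr_mmap_is_multiplicative (fun i x => hC i x) mC.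
Qed.

Lemma eval_atB z p q : eval_at z (p - q) = eval_at z p - eval_at z q.
Proof. exact: raddfB. Qed.

Lemma eval_at1 z : eval_at z 1 = 1.
Proof. by rewrite /eval_at -mpolyC1 mmapC; exact: rmorph1. Qed.

Lemma eval_atX z i : eval_at z 'X_i = z`_i.
Proof. by rewrite /eval_at mmapX mmap1U. Qed.

Lemma stable_eval_at z : (forall x, x \in z -> central x) ->
  stable (scalars_and z) [set f | exists p m, M m /\ f = eval_at z p + m].
Proof.
move=> zC; have [M0 MD MM] := idM; split.
- by exists 0, 0; rewrite /eval_at raddf0 addr0.
- move=> _ _ [p [m [Mm ->]]] [q [n [Mn ->]]]; exists (p + q), (m + n).
  by rewrite /eval_at raddfD addrACA; split=> //; apply: MD.
- move=> x _ [[d ->]|xz] [p [m [Mm ->]]].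
    exists (d *: p), (phi d * m).
    by rewrite /eval_at mmapZ mulrDr; split=> //; apply: MM.
  exists ('X_(Ordinal (etrans (index_mem x z) xz)) * p), (x * m).
  rewrite eval_atM // eval_atX nth_index // mulrDr.
  by split=> //; apply: MM.
Qed.

Lemma algebraic_of_maximal z : maximal_stable setT M ->
    (forall x, x \in z -> central x) -> finite_over z -> (0 < size z)%N ->
  exists2 p, p != 0 & M (eval_at z p).
Proof.
move=> [_ MT Mmax] zC zfin z0; apply: contrapT => noalg.
have indep p : M (eval_at z p) -> p = 0.
  by move=> Mp; apply: contrapT => /eqP p0; apply: noalg; exists p.
have [M0 MD MM] := idM; pose X0 : {mpoly D[size z]} := 'X_(Ordinal z0).
set c := z`_0; have cC : central c by apply: nth_central.
have X0E : eval_at z X0 = c by rewrite eval_atX.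
have cM : ~ M c.
  rewrite -X0E => /indep /(congr1 (mcoeff U_(Ordinal z0))).
  by rewrite mcoeffXU eqxx mcoeff0 => /eqP; rewrite oner_eq0.
(* [c T + M] is a left ideal because [c] is central, and it contains [c], which is not in [M]; so it
   is everything. *)
have csurj f : exists g m, M m /\ f = c * g + m.
  pose U := [set f | exists g m, M m /\ f = c * g + m].
  suff : U = setT by move=> UT; have : U f by rewrite UT.
  have [||UM|//] := Mmax U.
  - split; first by exists 0, 0; rewrite mulr0 addr0.
      move=> _ _ [g [m [Mm ->]]] [h [n [Mn ->]]]; exists (g + h), (m + n).
      by rewrite mulrDr addrACA; split=> //; apply: MD.
    move=> a _ _ [g [m [Mm ->]]]; exists (a * g), (a * m).
    by rewrite mulrDr !mulrA (cC a); split=> //; apply: MM.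
  - by move=> m Mm; exists 0, m; rewrite mulr0 add0r.
  - case: cM; rewrite -UM; exists 1, 0.
    by rewrite mulr1 addr0.
have onec k : exists g m, M m /\ 1 = c ^+ k * g + m.
  elim: k => [|k [g [m [Mm ->]]]]; first by exists 1, 0; rewrite mul1r addr0.
  have [h [n [Mn ->]]] := csurj g; exists h, (c ^+ k * n + m).
  rewrite exprSr mulrDr mulrA addrA; split=> //.
  by apply: MD => //; apply: MM.
pose A := [set f | exists p m, M m /\ f = eval_at z p + m].
have As : stable (scalars_and z) A by apply: stable_eval_at.
have [A0 AD AM] := As.
have Ac f : A f -> A (c * f) by apply: AM; right; apply: mem_nth.
(* [N k] plays the role of [c^(-k) A]. *)
pose N k := [set f | A (c ^+ k * f)].
have [||||k Nk] := acc_finite_over z zC zfin N => //.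
- move=> k; split; rewrite /N /=.
  + by rewrite mulr0.
  + by move=> x y Ax Ay; rewrite mulrDr; apply: AD.
  + by move=> a x Pa Ax; rewrite mulrA -(commrX k (cC a)) -mulrA; apply: AM.
- by move=> k f; rewrite /N /= exprS -mulrA; apply: Ac.
- move=> k m Mm; exists 0, (c ^+ k * m).
  by rewrite /eval_at raddf0 add0r; split=> //; apply: MM.
have [g [m [Mm oneE]]] := onec k.+1.
have : N k g.
  apply: (Nk k.+1 (leqnSn k)); exists 1, (- m).
  by rewrite eval_at1 oneE addrK -mulN1r; split=> //; apply: MM.
move=> [p [n [Mn ckg]]].
have /indep/(congr1 (mcoeff 0%MM)) : M (eval_at z (1 - X0 * p)).
  rewrite eval_atB eval_at1 eval_atM // X0E.
  rewrite {1}oneE exprS -mulrA ckg mulrDr -[in c * eval_at z p + _ + m]addrA.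
  rewrite [c * _ + (_ + _)]addrC addrK.
  by apply: MD => //; apply: MM.
(* The constant coefficient of [1 - X0 * p] is 1, so this polynomial cannot vanish. *)
rewrite mcoeffB rmorphM /= mcoeff1 eqxx /X0 mcoeffX mnm1_eq0 mul0r subr0 mcoeff0.
by move/eqP; rewrite oner_eq0.
Qed.

(* [f] is [y ^+ k] plus a combination of lower powers of [y] with coefficients
   in the ring generated by [w]. *)
Definition monic_in (y : T) (w : seq T) (f : T) (k : nat) : Prop :=
  central f /\ forall U t, stable (scalars_and w) U ->
    (forall j, (j < k)%N -> U (y ^+ j * t)) -> U ((f - y ^+ k) * t).

Section MonicIn.
Context {y : T} {w : seq T}.
Hypothesis yC : central y.

Lemma monic_in1 : monic_in y w 1 0.
Proof.
split=> [x|U t [U0 _ _] _]; first exact: commr1.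
by rewrite subrr mul0r.
Qed.

Lemma monic_inM f g k l : monic_in y w f k -> monic_in y w g l ->
  monic_in y w (f * g) (k + l).
Proof.
move=> [fC fk] [gC gl]; split=> [x|U t Us Ut]; first exact: commrM.
set a := f - y ^+ k in fk; set b := g - y ^+ l in gl.
have bC x : x * b = b * x.
  by rewrite mulrBr mulrBl (gC x) (commrX l (yC x)).
have [_ UD UM] := Us.
(* Each of the three terms reduces to powers of [y] below [k + l]. *)
have -> : f * g - y ^+ (k + l) = a * b + (a * y ^+ l + b * y ^+ k).
  have -> : f = a + y ^+ k by rewrite subrK.
  have -> : g = b + y ^+ l by rewrite subrK.
  by clearbody a b; rewrite mulrDl !mulrDr exprD !addrA addrK (bC (y ^+ k)).
clearbody a b; rewrite !mulrDl -!mulrA.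
apply: (UD).
  apply: (fk U) => // j jk; rewrite mulrA bC -mulrA; apply: (gl U) => // i il.
  by rewrite mulrA -exprD; apply: Ut; rewrite addnC -addSn leq_add // ltnW.
apply: UD.
  apply: (fk U) => // j jk; rewrite mulrA -exprD.
  by apply: Ut; rewrite ltn_add2r.
apply: (gl U) => // j jl; rewrite mulrA -exprD.
by apply: Ut; rewrite addnC ltn_add2l.
Qed.

Lemma monic_inX f k n : monic_in y w f k -> monic_in y w (f ^+ n) (k * n).
Proof.
move=> fk; elim: n => [|n IHn]; first by rewrite muln0; apply: monic_in1.
by rewrite exprS mulnS; apply: monic_inM.
Qed.

Lemma monic_in_prod n (h : 'I_n -> T) (e m : 'I_n -> nat) :
  (forall i, monic_in y w (h i) (e i)) ->
  monic_in y w (\prod_(i < n) h i ^+ m i) (\sum_(i < n) e i * m i).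
Proof.
move=> he; elim/big_ind2: _ => [|f k g l|i _].
- exact: monic_in1.
- exact: monic_inM.
- exact: monic_inX.
Qed.
End MonicIn.

(* Nagata's change of variables: the exponents [B ^ i] give different monomials
   of the relation different degrees in [y]. *)
Lemma finite_over_eliminate y z (p : {mpoly D[size (y :: z)]}) :
    (forall x, x \in y :: z -> central x) -> p != 0 ->
    M (eval_at (y :: z) p) -> finite_over (y :: z) ->
  exists w, [/\ size w = size z, forall x, x \in w -> central x &
                finite_over w].
Proof.
move=> zC p0 Mp [s sC zs].
have yC : central y by apply: zC; rewrite in_cons eqxx.
set r := size (y :: z); pose B := msize p.
(* In [y :: z], [y] has index 0 and degree [B ^ 0], while the [i]-th entry of [z] has index [i.+1];
   hence the exponent. *)
pose w := mkseq (fun i => z`_i - y ^+ (B ^ i.+1)) (size z).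
pose wt (m : 'X_{1..r}) := (\sum_(i < r) B ^ i * m i)%N.
have B0 : (0 < B)%N by rewrite lt0n msize_poly_eq0.
have zmon (i : 'I_r) : monic_in y w (y :: z)`_i (B ^ i).
  split=> [|U t [U0 _ UM] Ut]; first exact: nth_central.
  case: i Ut => [[|i] iz] /= Ut; first by rewrite expr1 subrr mul0r.
  have Pw : scalars_and w (z`_i - y ^+ (B ^ i.+1)).
    by right; apply/mapP; exists i; rewrite // mem_iota.
  by apply: UM => //; rewrite -[t]mul1r; apply: (Ut 0); rewrite expn_gt0 B0.
have mon m : monic_in y w (mmap1 (fun i : 'I_r => (y :: z)`_i) m) (wt m).
  exact: monic_in_prod.
have wt_inj m m' : m \in msupp p -> m' \in msupp p -> wt m = wt m' -> m = m'.
  have small k i : k \in msupp p -> (k i < B)%N.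
    move=> /msize_mdeg_lt; apply: leq_ltn_trans.
    by rewrite mdegE (bigD1 i) //= leq_addr.
  by move=> mp m'p /base_expansion_inj E; apply/mnmP/E => i; apply: small.
have [m0 m0p m0max] : exists2 m0, m0 \in msupp p &
    forall m, m \in msupp p -> (wt m <= wt m0)%N.
  case: (@ex_maxnP (fun k => has (fun m => wt m == k) (msupp p))
           (\max_(m <- msupp p) wt m)%N).
  - exists (wt (head 0%MM (msupp p))); apply/hasP.
    exists (head 0%MM (msupp p)) => //.
    by case E : (msupp p) => [|m ms]; rewrite ?mem_head //;
       move/eqP: E; rewrite msupp_eq0 (negbTE p0).
  - by move=> k /hasP[m mp /eqP<-]; apply: leq_bigmax_seq.
  - move=> k /hasP[m0 m0p /eqP <-] kmax; exists m0 => // m mp; apply: kmax.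
    by apply/hasP; exists m.
set d := wt m0.
(* Only [m0] has weight [d], and its coefficient is a unit, so the relation can be solved for
   [y ^+ d]. *)
have reduce U t : stable (scalars_and w) U -> M `<=` U -> central t ->
    (forall j, (j < d)%N -> U (y ^+ j * t)) -> U (y ^+ d * t).
  move=> Us MU tC Ut; have [U0 UD UM] := Us.
  have subU a b : U a -> U b -> U (a - b).
    exact: stableB (scalars_andN1 w) Us.
  pose ev m := mmap1 (fun i : 'I_r => (y :: z)`_i) m.
  have Uev m : m \in msupp p -> m != m0 -> U (ev m * t).
    move=> mp mm0; have md : (wt m < d)%N.
      rewrite ltn_neqAle m0max // andbT.
      by apply: contra mm0 => /eqP/wt_inj-> //.
    rewrite -[ev m](subrK (y ^+ wt m)) mulrDl; apply: UD; last exact: Ut.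
    by apply: (mon m).2 => // j jm; apply/Ut/(ltn_trans jm).
  have Um0 : U (phi p@_m0 * (ev m0 * t)).
    have : U (eval_at (y :: z) p * t).
      by apply: MU; rewrite tC; have [_ _] := idM; apply.
    rewrite /eval_at /mmap (bigD1_seq m0) ?msupp_uniq //= mulrDl -mulrA.
    set rest := (X in _ + X) => Urest.
    rewrite -[X in U X](addrK rest); apply: subU Urest _.
    rewrite /rest mulr_suml big_seq_cond; apply: stable_sum Us _.
    move=> m /andP[mp mm0]; rewrite -mulrA.
    by apply: UM; [exact: scalars_andC|exact: Uev].
  have {}Um0 : U (ev m0 * t).
    rewrite -[ev m0 * t]mul1r -(rmorph1 phi) -(@mulVr _ p@_m0).
      by rewrite rmorphM -mulrA; apply: UM => //; apply: scalars_andC.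
    by apply: hD; rewrite -mcoeff_msupp.
  rewrite -[y ^+ d * t](subKr (ev m0 * t)) -mulrBl; apply: subU => //.
  exact: (mon m0).2.
exists w; split; first by rewrite size_mkseq.
  move=> x /mapP[i _ ->] f; apply: commrB; last exact: commrX.
  by apply: (nth_central (y :: z) i.+1).
exists [seq y ^+ j * t | j <- iota 0 d, t <- s].
  move=> _ /allpairsP[[j t] /= [_ ts ->]] f; apply: commrM; first exact: commrX.
  exact: sC.
move=> U Us MU Us'; have [U0 UD UM] := Us.
(* This part of [U] is closed under [y] and under [w], hence under [z], so the generation hypothesis
   for [y :: z] applies. *)
suff VT : [set f | forall j, U (y ^+ j * f)] = setT.
  apply/seteqP; split=> // f _; rewrite -[f]mul1r.
  suff Vf : [set f | forall j, U (y ^+ j * f)] f by apply: (Vf 0).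
  by rewrite VT.
apply: zs.
- split=> [j|f g Vf Vg j|q f zq Vf j]; first by rewrite mulr0.
    by rewrite mulrDr; apply: UD.
  have swap a : y ^+ j * (a * f) = a * (y ^+ j * f).
    by rewrite !mulrA (commrX j (yC a)).
  case: zq => [[c ->]|]; first by rewrite swap; apply: UM; [exact: scalars_andC|].
  rewrite in_cons => /predU1P[->|/(nthP 0)[i iz <-]].
    by rewrite mulrA -exprSr.
  have -> : z`_i = w`_i + y ^+ (B ^ i.+1) by rewrite nth_mkseq // subrK.
  rewrite mulrDl mulrDr; apply: UD; last by rewrite mulrA -exprD.
  by rewrite swap; apply: UM => //; right; apply: mem_nth; rewrite size_mkseq.
- by move=> m Mm j; apply: MU; have [_ _] := idM; apply.
- move=> t ts j; elim/ltn_ind: j => j IHj.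
  have [jd|dj] := ltnP j d.
    by apply/Us'/allpairsP; exists (j, t); rewrite mem_iota.
  rewrite -(subnKC dj) exprD -mulrA; apply: reduce => //.
    by move=> f; apply: commrM; [exact: commrX|exact: sC].
  move=> i id; rewrite mulrA -exprD; apply: IHj.
  by rewrite -{2}(subnKC dj) ltn_add2r.
Qed.

(** As long as a variable is left, maximality of [M] supplies a relation that eliminates one, so the
    process ends at [D] itself. *)
Lemma amitsur_small z : maximal_stable setT M ->
  (forall x, x \in z -> central x) -> finite_over z -> finite_over [::].
Proof.
move=> Mmax; have [n] := ubnP (size z); elim: n z => // n IHn [//|y z] zn zC zfin.
have [p p0 Mp] := algebraic_of_maximal _ Mmax zC zfin isT.
have [w [wz wC wfin]] := finite_over_eliminate _ _ _ zC p0 Mp zfin.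
by apply: IHn wfin => //; rewrite wz.
Qed.
End NoetherNormalization.

(** * The Rabinowitsch trick over a noncommutative ring *)

Section Rabinowitsch.
Context {R : nzRingType} {I : set R}.
Hypothesis idI : left_ideal I.

(* The left ideal of [R['X]] generated by [I] and [1 - 'X a]; in the quotient,
   [a] becomes invertible. *)
Definition rabinowitsch_ideal (a : R) : set {poly R} :=
  [set f | exists q h : {poly R},
     (forall i, I h`_i) /\ f = q * (1 - 'X * a%:P) + h].

Lemma stable_rabinowitsch_ideal a : stable setT (rabinowitsch_ideal a).
Proof.
have [I0 ID IM] := idI; split.
- by exists 0, 0; rewrite mul0r addr0; split=> // i; rewrite coef0.
- move=> _ _ [q [h [Ih ->]]] [q' [h' [Ih' ->]]]; exists (q + q'), (h + h').
  by rewrite mulrDl addrACA; split=> // i; rewrite coefD; apply: ID.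
- move=> p _ _ [q [h [Ih ->]]]; exists (p * q), (p * h).
  rewrite mulrDr mulrA; split=> // i; rewrite coefM.
  by elim/big_ind: _ => // j _; apply: IM.
Qed.

(** In [1 = q * (1 - 'X a) + h], comparing coefficients gives [q_k = q_(k-1) a - h_k] for [k > 0].
    Solve this recursion and use that [q_k] vanishes at [k = size q]. *)
Lemma left_power_sum_of_rabinowitsch a : rabinowitsch_ideal a 1 ->
  exists N, (1 <= N)%N /\ left_power_sum I a N (a ^+ N).
Proof.
have [I0 ID IM] := idI; move=> [q [h [Ih oneE]]].
have hE i : h`_i = (i == 0)%:R - q`_i + (if i is j.+1 then q`_j * a else 0).
  have aux (x y t : R) : t = x - y + t - x + y.
    by rewrite -[x - y + t]addrA [x + _]addrC addrK [- y + t]addrC subrK.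
  rewrite -coef1 oneE coefD mulrBr mulr1 mulrA coefB coefMC coefMX.
  by case: i => [|i] /=; rewrite ?mul0r; apply: aux.
have qE k : q`_k = a ^+ k - \sum_(i < k.+1) h`_i * a ^+ (k - i).
  elim: k => [|k IHk].
    by rewrite big_ord_recr big_ord0 /= hE eqxx !mulr1 add0r addr0 subKr.
  rewrite big_ord_recr /= subnn mulr1 hE /= sub0r IHk mulrBl -exprSr.
  have -> : (\sum_(i < k.+1) h`_i * a ^+ (k - i)) * a =
      \sum_(i < k.+1) h`_i * a ^+ (k.+1 - i).
    rewrite mulr_suml; apply: eq_bigr => i _.
    by rewrite -mulrA -exprSr subSn // -ltnS.
  set S := \sum_(i < _) _.
  by rewrite addrCA [S + _]addrC subrK opprD opprK addrC subrK.
set n := size q.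
(* The relation for [a ^+ n] still involves [a ^+ n] on the right. A left factor [a] raises the left
   side to [a ^+ n.+1] and keeps the coefficients in [I]. *)
exists n.+1; split=> //; exists (fun i : 'I_n.+1 => a * h`_(n - i)).
  by move=> i; apply: IM.
have : q`_n = 0 by rewrite nth_default.
rewrite qE => /eqP; rewrite subr_eq0 => /eqP anE.
rewrite exprS {1}anE mulr_sumr (reindex_inj rev_ord_inj) /=.
apply: eq_bigr => i _; rewrite mulrA subSS; congr (_ * _ ^+ _).
by rewrite subKn // -ltnS.
Qed.
End Rabinowitsch.

(** * From maximal left ideals of [R['X]] to maximal left ideals of [R] *)

Definition constants {R : nzRingType} : set {poly R} := [set b%:P | b in setT].

(* The powers ['X ^+ i] move a maximal [R]-submodule [N] of [R['X]] around so
   that it shrinks to [M]. *)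
Lemma maximal_left_ideal_contract {R : nzRingType} {M N : set {poly R}} (a : R) :
    maximal_stable setT M -> maximal_stable constants N -> M `<=` N ->
    ~ M a%:P ->
  exists M0, [/\ maximal_left_ideal M0, forall b, M b%:P -> M0 b & ~ M0 a].
Proof.
move=> [Ms MT Mmax] [Ns NT Nmax] MN Ma; have [M0 MD MM] := Ms.
have [N0 ND NM] := Ns.
pose C := [set f | forall i, N ('X^i * f)].
have NC b f : N f -> N (b%:P * f) by apply: NM; exists b.
have XC (i : nat) (b : R) f : 'X^i * (b%:P * f) = b%:P * ('X^i * f).
  by rewrite !mulrA (commr_polyXn b%:P i).
(* [C] is a left ideal containing [M] and contained in the proper subset [N]. *)
have CM : C = M.
  have [||//|CT] := Mmax C.
  - split=> [i|f g Cf Cg i|p f _ Cf].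
    + by rewrite mulr0.
    + by rewrite mulrDr; apply: ND.
    + elim/poly_ind: p => [|p b IHp] i; first by rewrite mul0r mulr0.
      rewrite mulrDl mulrDr; apply: ND; last by rewrite XC; apply: NC.
      by rewrite commr_polyX -['X * p * f]mulrA mulrA -exprSr; apply: IHp.
  - by move=> f Mf i; apply/MN/MM.
  case: NT; apply/seteqP; split=> // f _.
  by have : C f; [rewrite CT|move/(_ 0); rewrite mul1r].
have [i Nia] : exists i, ~ N ('X^i * a%:P).
  apply: contrapT => noi; apply: Ma; rewrite -CM => i.
  by apply: contrapT => Ni; apply: noi; exists i.
(* This is the kernel of a nonzero [R]-linear map from [R] to the simple module [R['X] / N], hence
   maximal. *)
exists [set b | N ('X^i * b%:P)]; split=> //; last first.
  by move=> b Mb; apply/MN/MM.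
split=> [|E|J Js NJ].
- split=> [|b c Nb Nc|b c Nc]; rewrite /= ?mulr0 //.
  + by rewrite polyCD mulrDr; apply: ND.
  + by rewrite polyCM XC; apply: NC.
- by apply: Nia; have : [set: R] a by []; rewrite -E.
have [J0 JD JM] := Js.
have [JN|/existsNP[b /not_implyP[Jb Nb]]] :=
    pselect (forall b, J b -> N ('X^i * b%:P)).
  by left; apply/seteqP.
right; apply/seteqP; split=> // c _; rewrite -[c]mulr1; apply: (JM).
pose N' := [set f | exists g r, N g /\ f = g + r%:P * ('X^i * b%:P)].
have N'T : N' = setT.
  have [||N'N|//] := Nmax N'.
  - split.
    + by exists 0, 0; rewrite mul0r addr0.
    + move=> _ _ [g [r [Ng ->]]] [g' [r' [Ng' ->]]]; exists (g + g'), (r + r').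
      by rewrite polyCD mulrDl addrACA; split=> //; apply: ND.
    + move=> _ _ [d _ <-] [g [r [Ng ->]]]; exists (d%:P * g), (d * r).
      by rewrite polyCM mulrDr -mulrA; split=> //; apply: NC.
  - by move=> f Nf; exists f, 0; rewrite mul0r addr0.
  case: Nb; rewrite -N'N; exists 0, 1.
  by rewrite mul1r add0r.
have : N' 'X^i by rewrite N'T.
move=> [g [r [Ng XE]]]; rewrite -[1](subrK (r * b)); apply: JD; last exact: JM.
apply: NJ; rewrite /= polyCB mulrBr mulr1 polyCM XC.
by rewrite {1}XE addrK.
Qed.

(** * Central generators of [D[x_1, ..., x_n]['X]] over [D] *)

Section PolynomialRing.
Context {D : unitRingType} {n : nat}.
Local Notation T := {poly {mpoly D[n]}}.

Definition scalar_const : {rmorphism D -> T} :=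
  (@polyC {mpoly D[n]} \o @mpolyC n D : {rmorphism D -> T}).

Definition poly_vars : seq T := 'X :: [seq ('X_i)%:P | i <- enum 'I_n].

Lemma poly_vars_central x : x \in poly_vars -> central x.
Proof.
rewrite in_cons => /predU1P[->|/mapP[i _ ->]] p; first exact: commr_polyX.
apply/polyP => k; rewrite coefMC coefCM; exact: commr_mpolyX.
Qed.

Lemma finite_over_poly_vars (M : set T) :
  finite_over (phi := scalar_const) (M := M) poly_vars.
Proof.
exists [:: 1] => [t|U [U0 UD UM] _ U1].
  by rewrite inE => /eqP-> x; apply: commr1.
apply/seteqP; split=> // p _.
have {}U1 : U 1 by apply: U1; rewrite mem_head.
have UX i u : U u -> U (('X_i)%:P * u).
  apply: UM; right; rewrite in_cons; apply/orP; right.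
  by apply/mapP; exists i; rewrite ?mem_enum.
have UXm m u : U u -> U ('X_[m]%:P * u).
  move=> Uu; rewrite mpolyXE_id rmorph_prod /=.
  elim/big_rec: _ => [|i x _ Ux]; first by rewrite mul1r.
  rewrite -mulrA rmorphXn /=; elim: (m i) => [|k IHk]; first by rewrite mul1r.
  by rewrite exprS -mulrA; apply: UX.
elim/poly_ind: p => [//|p c Up]; apply: (UD).
  by rewrite commr_polyX; apply: (UM) => //; right; apply: mem_head.
elim/mpolyind: c => [//|c m q _ _ Uq]; rewrite polyCD; apply: UD => //.
rewrite -mul_mpolyC polyCM; apply: UM; first by left; exists c.
by rewrite -['X_[m]%:P]mulr1; apply: UXm.
Qed.
End PolynomialRing.

(** * The two inclusions *)

Theorem theorem1p9 (D : unitRingType) (hD : division_ring D) (n : nat)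
    (hn : (1 <= n)%N) (I : set {mpoly D[n]}) (hI : left_ideal I) :
  \bigcap_(M in [set M : set {mpoly D[n]} |
                  maximal_left_ideal M /\ I `<=` M]) M =
  [set f : {mpoly D[n]} |
    forall g : {mpoly D[n]}, exists N : nat,
      (1 <= N)%N /\ left_power_sum I (g * f) N ((g * f) ^+ N)].
Proof.
apply/seteqP; split=> f.
  move=> radf g; set a := g * f; apply: (left_power_sum_of_rabinowitsch hI).
  apply: contrapT => J1; pose J := rabinowitsch_ideal (I := I) a.
  have Js : stable setT J by apply: stable_rabinowitsch_ideal.
  have [||M Mmax JM] := exists_maximal_stable setT J [:: 1] Js.
  - by move=> JT; apply: J1; rewrite -/J JT.
  - move=> U [_ _ UM] _ U1; apply/seteqP; split=> // x _.
    by rewrite -[x]mulr1; apply: UM => //; apply: U1; rewrite mem_head.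
  have [Ms MT _] := Mmax; have [_ MD MM] := Ms.
  have [s _ Mgen] := amitsur_small hD Ms _ Mmax poly_vars_central
    (finite_over_poly_vars M).
  (* Finite generation over [D] passes to the larger ring of constants and yields a maximal
     submodule over it. *)
  have [|||N Nmax MN] := exists_maximal_stable constants M s.
  - exact: stable_sub Ms.
  - exact: MT.
  - move=> U Us; apply: Mgen; apply: stable_sub Us => _ [[d ->]|//].
    by exists d%:MP.
  (* ['X a] is 1 modulo [M], so [a] in [M] would put 1 in [M]. *)
  have Ma : ~ M a%:P.
    move=> Ma; apply: MT; apply/seteqP; split=> // x _; rewrite -[x]mulr1.
    apply: (MM) => //; rewrite -[1](subrK ('X * a%:P)); apply: MD.
      apply: JM; exists 1, 0; rewrite mul1r addr0; split=> // i.
      by rewrite coef0; have [] := hI.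
    exact: MM.
  have [M0 [M0max MM0 M0a]] := maximal_left_ideal_contract a Mmax Nmax MN Ma.
  apply: M0a; have [[_ _ M0M] _ _] := M0max; apply: M0M; apply: radf.
  split=> // b Ib; apply: MM0; apply: JM; exists 0, b%:P.
  rewrite mul0r add0r; split=> // i; rewrite coefC.
  by case: eqP => // _; have [] := hI.
move=> radf M [Mmax IM]; apply: contrapT => Mf.
have [[M0 MD MM] MT Mm] := Mmax.
(* Modulo [M] some multiple [g * f] is [1], so the relation for [g * f] puts
   [1] in [M]. *)
have [g Mg] : exists g, M (1 - g * f).
  pose U := [set u | exists g m, M m /\ u = g * f + m].
  have [||UM|UT] := Mm U.
  - split; first by exists 0, 0; rewrite mul0r addr0.
      move=> _ _ [g [m [Im ->]]] [h [k [Ik ->]]]; exists (g + h), (m + k).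
      by rewrite mulrDl addrACA; split=> //; apply: MD.
    move=> b _ [g [m [Im ->]]]; exists (b * g), (b * m).
    by rewrite mulrDr mulrA; split=> //; apply: MM.
  - by move=> m Im; exists 0, m; rewrite mul0r add0r.
  - by case: Mf; rewrite -UM; exists 1, 0; rewrite mul1r addr0.
  have [g [m [Im oneE]]] : U 1 by rewrite UT.
  by exists g; rewrite oneE addrC addKr.
set a := g * f in Mg.
(* [M] is only a left ideal, so the factor [1 - a] must be split off on the right. *)
have Ma k : M (1 - a ^+ k).
  elim: k => [|k IHk]; first by rewrite subrr.
  have -> : 1 - a ^+ k.+1 = 1 - a ^+ k + a ^+ k * (1 - a).
    by rewrite mulrBr mulr1 -exprSr addrA subrK.
  by apply: MD => //; apply: MM.
have [N [_ [r Ir aN]]] := radf g; rewrite -/a in aN.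
apply: MT; apply/seteqP; split=> // x _; rewrite -[x]mulr1; apply: (MM).
rewrite -[1](subrK (a ^+ N)); apply: (MD) => //; rewrite aN.
(* Modulo [M], each [r i * a ^+ i] equals [r i], which lies in [I]. *)
elim/big_ind: _ => // i _; have -> : r i * a ^+ i = r i + - r i * (1 - a ^+ i).
  by rewrite mulrBr mulr1 mulNr opprK addrA subrr add0r.
by apply: MD; [exact/IM/Ir|exact: MM].
Qed.
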